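(* Let $d\geq 2$ and $1\leq\ell\leq d-1$ be integers. Let $\gamma_\ell^d$ be the tautological vector bundle over the Grassmann manifold $G_\ell(\mathbb{R}^d)$ of $\ell$-dimensional linear subspaces of $\mathbb{R}^d$, with total space $E(\gamma_\ell^d)$. For every collection of $d$ sections $s_1,\dots,s_d\colon G_\ell(\mathbb{R}^d)\to E(\gamma_\ell^d)$ of $\gamma_\ell^d$, there exist a subspace $L\in G_\ell(\mathbb{R}^d)$ and an affine hyperplane $H$ in $L$ such that $s_1(L)\in H,\dots,s_d(L)\in H$.
   Context: Sections are continuous; a section $s$ of $\gamma_\ell^d$ assigns to each $L\in G_\ell(\mathbb{R}^d)$ a point $s(L)\in L$. An affine hyperplane in $L$ is an affine subspace of $L$ of dimension $\ell-1$ (a point when $\ell=1$). *)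

(* Defs.v *)
From HB Require Import structures.
From mathcomp Require Import all_boot all_order all_algebra.
From mathcomp Require Import all_classical all_reals all_analysis.

Set Implicit Arguments.
Unset Strict Implicit.
Unset Printing Implicit Defensive.

Import GRing.Theory.
Import numFieldNormedType.Exports.

Local Open Scope classical_set_scope.
Local Open Scope ring_scope.

Section Grassmannian.
Variables (R : realType) (d l : nat).

Definition frame_rows (A : 'M[R]_(l, d)) : l.-tuple 'rV[R]_d :=
  [tuple row i A | i < l].

(* The Stiefel manifold of linearly independent (not necessarily orthonormal)
   l-frames, as a subspace of the space of matrices. *)
Definition frames : set 'M[R]_(l, d) := [set A | free (frame_rows A)].
Definition stiefel : Type := set_type frames.
HB.instance Definition _ := Topological.on stiefel.

Record subspace_of_dim := SubspaceOfDim {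
  subspace_val : {vspace 'rV[R]_d};
  subspace_valP : \dim subspace_val == l }.
HB.instance Definition _ := [isSub for subspace_val].
HB.instance Definition _ := [Choice of subspace_of_dim by <:].

Lemma span_frame_dim (A : stiefel) : \dim <<frame_rows (set_val A)>> == l.
Proof.
have freeA : free (frame_rows (set_val A)) by exact: (set_valP A).
by rewrite (eqnP freeA) size_tuple.
Qed.

Definition span_frame (A : stiefel) : subspace_of_dim :=
  SubspaceOfDim (span_frame_dim A).

Definition basis_mx (L : subspace_of_dim) : 'M[R]_(l, d) :=
  \matrix_(i < l) (vbasis (subspace_val L))`_i.

Lemma frame_rows_basis (L : subspace_of_dim) :
  frame_rows (basis_mx L) = vbasis (subspace_val L) :> seq _.
Proof.
have dimL := eqP (subspace_valP L).
apply: (@eq_from_nth _ 0); rewrite size_tuple ?size_tuple ?dimL // => i il.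
by rewrite -(tnth_nth _ _ (Ordinal il)) tnth_mktuple rowK.
Qed.

Lemma basis_frames (L : subspace_of_dim) : basis_mx L \in frames.
Proof.
rewrite inE /frames /= frame_rows_basis.
exact: basis_free (vbasisP _).
Qed.

Definition basis_frame (L : subspace_of_dim) : stiefel :=
  SigSub (basis_frames L).

Lemma basis_frameK : cancel basis_frame span_frame.
Proof.
move=> L; apply: val_inj => /=.
by rewrite set_valE /= frame_rows_basis; exact: span_basis (vbasisP _).
Qed.

(* basis_frame is an arbitrary choice of representatives: the quotient topology
   depends only on the projection span_frame. *)
HB.instance Definition _ :=
  isQuotient.Build stiefel subspace_of_dim basis_frameK.

Definition grassmannian : Type := quotient_topology subspace_of_dim.
HB.instance Definition _ := Topological.on grassmannian.

Definition gr_space (L : grassmannian) : {vspace 'rV[R]_d} :=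
  subspace_val L.

Definition taut_total : Type :=
  set_type [set p : grassmannian * 'rV[R]_d | p.2 \in gr_space p.1].
HB.instance Definition _ := Topological.on taut_total.

Definition taut_proj (e : taut_total) : grassmannian := (set_val e).1.
Definition taut_vec (e : taut_total) : 'rV[R]_d := (set_val e).2.

Definition taut_section (s : grassmannian -> taut_total) : Prop :=
  continuous s /\ forall L, taut_proj (s L) = L.

End Grassmannian.

Definition affine_subspace (R : realType) (d k : nat) (H : set 'rV[R]_d) :
    Prop :=
  exists (p : 'rV[R]_d) (V : {vspace 'rV[R]_d}),
    \dim V = k /\ H = [set p + v | v in [set v | v \in V]].

Definition affine_hyperplane_in (R : realType) (d l : nat)
    (L : grassmannian R d l) (H : set 'rV[R]_d) : Prop :=
  H `<=` [set v | v \in gr_space L] /\ affine_subspace (l - 1) H.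

(* Main.v *)
Require Import Defs.
From HB Require Import structures.
From mathcomp Require Import all_boot all_order all_algebra.
From mathcomp Require Import ring lra.
From mathcomp Require Import all_classical all_reals all_analysis.

(** Write [t_i = s_i - s_d].  If some nonzero [w] in [L] is orthogonal to every
    [t_i(L)], then all the [s_i(L)] lie in the hyperplane of [L] through
    [s_d(L)] with normal [w] ([hyperplane_of_normal]).  Put [k = l - 1] and
    [n = d - l]; such an [L] is already found among the spaces
    [L(x) = R^k + R x], where [x] is a nonzero vector of [R^(n+1)] and [R^d] is
    split as [R^k + R^(n+1)].  The vectors of [L(x)] are the [w = u + c x] with
    [v = (u, c)] in [R^(k+1)], so what is sought is a zero, with [x] and [v]
    both nonzero, of the map [F(x, v)] to [R^(n+k)] whose coordinates are the
    inner products of [u + c x] with the [t_i(L(x))], [i < d].  Since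
    [L(-x) = L(x)], this map has two symmetries: [F(x, -v) = - F(x, v)] and
    [F(-x, v) = F(x, r v)], where [r] changes the sign of [c].

    Every continuous map with these symmetries has a zero
    ([exists_equivariant_zero]).  For [k = 0] this is the Borsuk-Ulam theorem;
    for maps linear in [v] it says that over projective [n]-space the sum of the
    tautological line bundle and of a trivial bundle of rank [k] does not embed
    in a trivial bundle of rank [n + k]: the complement would have rank [n - 1]
    and a nonzero Stiefel-Whitney class of degree [n].  The proof
    below is a direct mod 2 count.

    Let [e_i] be the upper hemisphere of the [i]-sphere and [T] the antipodal
    map in the variable [x]; let [f_j] be the upper hemisphere of the
    [j]-sphere and [nu] the antipodal map in the variable [v].  Modulo 2
    the boundary of [e_i x f_j] is [(1 + T)] of [e_(i-1) x f_j] plus [(1 + nu)]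
    of [e_i x f_(j-1)] ([boundary_cell]).  Both hemispheres are built by coning
    off the previous sphere towards a new coordinate vector, and this can be
    subdivided as finely as wanted ([suspension], [small_cell]).

    If [F] had no zero, then by compactness on each simplex of a fine
    subdivision of [e_n x f_k] some coordinate of [F] would keep a constant sign
    ([uniform_sign]).  Let [s_a] be the 0-cochain given by the sign of the
    coordinate [a]: the cup product of all the coboundaries of the [s_a], one
    for each of the [n + k] coordinates, vanishes on such a simplex
    ([cup_const]).  Yet its sum over [e_n x f_k] is 1 ([parity_cell]), by
    induction.  Indeed let [A(i, j)] be the sum over [e_i x f_j] of the product
    of the first [i + j] coboundaries.  That product is the coboundary of a
    cochain [phi], and [phi] plus its pullback by [nu] is the product of the
    first [i + j - 1] coboundaries.  The boundary formula thus shows that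
    [A(i, j)] is [A(i, j-1)] plus the sum of [phi] over [(1 + T)] of
    [e_(i-1) x f_j].  On functions of [F] the maps [T] and [r] have the same
    effect, and [r] fixes [f_j] for [j < k] but acts on [f_k] as [nu]; so that
    last sum is 0 if [j < k] and [A(i-1, k)] if [j = k].  From [A(0, 0) = 1]
    follows [A(n, k) = 1]. *)

Set Implicit Arguments.
Unset Strict Implicit.
Unset Printing Implicit Defensive.

Import Order.TTheory GRing.Theory Num.Theory.
Import numFieldNormedType.Exports.

(** * Chains modulo 2, prisms and suspensions *)

Section ChainsModTwo.
Variable X : eqType.

(** Chains are lists of ordered simplices, and cochains are boolean functions on
    simplices.  Two chains are equal modulo 2 when every cochain takes the same
    value on them; this is why identities modulo 2 are stated below through
    [pairing]. *)
Definition pairing (phi : seq X -> bool) (c : seq (seq X)) : bool :=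
  \big[addb/false]_(sg <- c) phi sg.

(** The complex is augmented: the only face of a vertex is [[::]]. *)
Fixpoint faces (sg : seq X) : seq (seq X) :=
  if sg is v :: sg' then sg' :: map (cons v) (faces sg') else [::].

Lemma faces_cons v sg : faces (v :: sg) = sg :: map (cons v) (faces sg).
Proof. by []. Qed.

Definition boundary (c : seq (seq X)) : seq (seq X) := flatten (map faces c).

Lemma pairing_cons phi sg c :
  pairing phi (sg :: c) = phi sg (+) pairing phi c.
Proof. by rewrite /pairing big_cons. Qed.

Lemma pairing_cat phi c1 c2 :
  pairing phi (c1 ++ c2) = pairing phi c1 (+) pairing phi c2.
Proof. by rewrite /pairing big_cat. Qed.

Lemma pairing_flatten phi cs :
  pairing phi (flatten cs) = \big[addb/false]_(c <- cs) pairing phi c.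
Proof. by rewrite /pairing big_flatten. Qed.

Lemma pairing_boundary phi c :
  pairing phi (boundary c) = pairing (fun sg => pairing phi (faces sg)) c.
Proof. by rewrite pairing_flatten big_map. Qed.

Lemma pairing_addb phi psi c :
  pairing (fun sg => phi sg (+) psi sg) c = pairing phi c (+) pairing psi c.
Proof. by rewrite /pairing big_split. Qed.

Lemma size_faces sg f : f \in faces sg -> (size f).+1 = size sg.
Proof.
elim: sg f => // v sg IH f; rewrite faces_cons inE => /predU1P[-> //|].
by case/mapP=> g /IH /= <- ->.
Qed.

End ChainsModTwo.

Arguments faces : simpl never.

Lemma eq_pairing (X : eqType) (phi psi : seq X -> bool) c :
  phi =1 psi -> pairing phi c = pairing psi c.
Proof. by move=> e; apply: eq_bigr => sg _; exact: e. Qed.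

Lemma pairing_map (X Y : eqType) (g : seq X -> seq Y) phi c :
  pairing phi (map g c) = pairing (phi \o g) c.
Proof. by rewrite /pairing big_map. Qed.

Lemma faces_map (X Y : eqType) (g : X -> Y) sg :
  faces (map g sg) = map (map g) (faces sg).
Proof. by elim: sg => // v sg IH; rewrite /= !faces_cons IH -!map_comp. Qed.

Section Prism.
Variables (X Y : eqType) (f g : X -> Y).

(** The triangulation of the prism over a simplex whose bottom is mapped by [f]
    and whose top is mapped by [g]. *)
Fixpoint prism (sg : seq X) : seq (seq Y) :=
  if sg is v :: sg' then
    (f v :: g v :: map g sg') :: map (cons (f v)) (prism sg')
  else [::].

Lemma prism_cons v sg : prism (v :: sg) =
  (f v :: g v :: map g sg) :: map (cons (f v)) (prism sg).
Proof. by []. Qed.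

(** A homotopy: the boundary of a prism consists of its bottom, its top and the
    prisms over the faces. *)
Lemma prism_boundary phi sg :
  pairing phi (boundary (prism sg)) =
  pairing (pairing phi \o prism) (faces sg)
    (+) (phi (map f sg) (+) phi (map g sg)).
Proof.
elim: sg phi => [|v sg IH] phi.
  by rewrite /boundary /pairing !big_nil addbb.
have IHv := IH (phi \o cons (f v)).
(* The first simplex of the prism over [v :: sg] contributes three kinds of
   faces; the others start with [f v], and the induction hypothesis for the
   cochain [phi \o cons (f v)] accounts for their remaining faces. *)
rewrite pairing_boundary prism_cons pairing_cons pairing_map faces_cons.
rewrite pairing_cons pairing_map faces_cons pairing_cons pairing_map.
rewrite faces_cons pairing_cons pairing_map.
rewrite pairing_boundary in IHv.
have -> : pairing ((fun sg0 => pairing phi (faces sg0)) \o cons (f v))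
    (prism sg) = pairing phi (prism sg) (+)
    (pairing (pairing (phi \o cons (f v)) \o prism) (faces sg)
     (+) (phi (f v :: map f sg) (+) phi (f v :: map g sg))).
  rewrite -IHv -pairing_addb; apply: eq_pairing => t /=.
  by rewrite faces_cons pairing_cons pairing_map.
rewrite faces_map pairing_map /=.
have -> : pairing ((pairing phi \o prism) \o cons v) (faces sg) =
   pairing (((phi \o cons (f v)) \o cons (g v)) \o map g) (faces sg) (+)
   pairing (pairing (phi \o cons (f v)) \o prism) (faces sg).
  rewrite -pairing_addb; apply: eq_pairing => t /=.
  by rewrite pairing_cons pairing_map.
set a1 := pairing _ _; set a2 := pairing _ _; set a3 := pairing _ _.
by case: (phi (g v :: _)) (phi (f v :: _)) (phi (f v :: _)) a1 a2 a3;
  do 5!case.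
Qed.

Lemma mem_prism sg t y : t \in prism sg -> y \in t ->
  exists2 x, x \in sg & y = f x \/ y = g x.
Proof.
elim: sg t => //= v sg IH t; rewrite inE => /predU1P[->|].
  rewrite !inE => /predU1P[->|/predU1P[->|/mapP[x xs ->]]].
  - by exists v; [exact: mem_head|left].
  - by exists v; [exact: mem_head|right].
  - by exists x; [rewrite inE xs orbT|right].
case/mapP=> t' /IH ht' ->; rewrite inE => /predU1P[->|/ht' [x xs e]].
  by exists v; [exact: mem_head|left].
by exists x => //; rewrite inE xs orbT.
Qed.

Lemma size_prism sg t : t \in prism sg -> size t = (size sg).+1.
Proof.
elim: sg t => //= v sg IH t; rewrite inE => /predU1P[->/=|].
  by rewrite size_map.
by case/mapP=> t' /IH /= <- ->.
Qed.

End Prism.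

Lemma map_prism (X Y Z : eqType) (f g : X -> Y) (h : Y -> Z) sg :
  map (map h) (prism f g sg) = prism (h \o f) (h \o g) sg.
Proof.
by elim: sg => //= v sg <-; rewrite -!map_comp.
Qed.

Lemma prism_map (X Y Z : eqType) (f g : Y -> Z) (h : X -> Y) sg :
  prism f g (map h sg) = prism (f \o h) (g \o h) sg.
Proof. by elim: sg => //= v sg ->; rewrite -!map_comp. Qed.

Lemma eq_prism (X Y : eqType) (f f' g g' : X -> Y) : f =1 f' -> g =1 g' ->
  prism f g =1 prism f' g'.
Proof.
move=> ef eg; elim=> //= v sg ->; rewrite ef eg (eq_map eg).
by congr cons; apply: eq_map => t; rewrite ef.
Qed.

Section Suspension.
Variables (X : eqType) (N : nat) (H : nat -> X -> X) (T : X -> X).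

(** [H 0], ..., [H N] are the successive stages of a discrete homotopy.  The
    chain [c + T c] is swept along it. *)
Definition suspension (c : seq (seq X)) : seq (seq X) :=
  flatten [seq flatten (map (prism (H t) (H t.+1)) (c ++ map (map T) c))
          | t <- iota 0 N].

(** The transpose of [suspension]: a sum over [suspension c] becomes a sum over
    [c], so that identities modulo 2 for [c] pass to its suspension. *)
Definition suspension_dual (phi : seq X -> bool) (sg : seq X) : bool :=
  \big[addb/false]_(t <- iota 0 N)
     (pairing phi (prism (H t) (H t.+1) sg) (+)
      pairing phi (prism (H t) (H t.+1) (map T sg))).

Lemma pairing_suspension phi c :
  pairing phi (suspension c) = pairing (suspension_dual phi) c.
Proof.
rewrite pairing_flatten big_map /= [RHS]exchange_big /=.
apply: eq_bigr => t _.
by rewrite pairing_flatten big_map big_cat big_map [RHS]big_split.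
Qed.

Lemma suspension_dual_nil phi : suspension_dual phi [::] = false.
Proof.
by rewrite /suspension_dual big1 // => t _; rewrite /pairing !big_nil.
Qed.

Hypothesis TK : involutive T.

Lemma suspension_dual_invol phi sg :
  suspension_dual phi (map T sg) = suspension_dual phi sg.
Proof.
by apply: eq_bigr => t _; rewrite (mapK TK) addbC.
Qed.

Hypothesis H0 : H 0 =1 id.
Hypothesis HN : forall x, H N (T x) = H N x.

(** When the homotopy starts at the identity and ends at a map that identifies
    [x] with [T x], the far ends of the prisms over [c] and [T c] cancel. *)
Lemma boundary_suspension phi c :
  pairing phi (boundary (suspension c)) =
  (pairing phi c (+) pairing phi (map (map T) c))
    (+) pairing (suspension_dual phi) (boundary c).
Proof.
pose c2 := c ++ map (map T) c.
(* The contributions of the stages telescope. *)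
have step t : pairing (fun sg => pairing phi (faces sg))
    (flatten (map (prism (H t) (H t.+1)) c2)) =
    pairing (pairing phi \o prism (H t) (H t.+1)) (boundary c2) (+)
   (pairing phi (map (map (H t)) c2) (+) pairing phi (map (map (H t.+1)) c2)).
  rewrite pairing_flatten big_map !pairing_map -pairing_addb pairing_boundary.
  rewrite -pairing_addb; apply: eq_bigr => sg _.
  by rewrite -prism_boundary pairing_boundary.
rewrite pairing_boundary pairing_flatten big_map.
rewrite (eq_bigr _ (fun t _ => step t)).
rewrite big_split /= addbC; congr (_ (+) _).
  have -> n : \big[addb/false]_(t <- iota 0 n)
     (pairing phi (map (map (H t)) c2) (+)
      pairing phi (map (map (H t.+1)) c2)) =
     pairing phi (map (map (H 0)) c2) (+) pairing phi (map (map (H n)) c2).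
    elim: n => [|n IHn]; first by rewrite big_nil addbb.
    rewrite -addn1 iotaD add0n big_cat IHn /= big_cons big_nil addbF addn1.
    set a := pairing _ _; set b := pairing _ _; set e := pairing _ _.
    by case: a b e => [] [] [].
  rewrite [X in _ (+) X](_ : _ = false); last first.
    rewrite /c2 map_cat pairing_cat -map_comp !pairing_map.
    rewrite -pairing_addb /pairing big1 // => sg _ /=.
    by rewrite -map_comp (eq_map HN) addbb.
  rewrite addbF -pairing_cat; congr pairing.
  rewrite -[RHS]map_id; apply: eq_map => sg.
  by rewrite (eq_map H0) map_id.
rewrite exchange_big /= -[LHS]/(pairing _ _) -/(pairing _ _).
rewrite /c2 /boundary map_cat flatten_cat pairing_cat -!/(boundary _).
rewrite !pairing_boundary pairing_map -pairing_addb; apply: eq_bigr => sg _ /=.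
rewrite faces_map pairing_map -pairing_addb; apply: eq_bigr => f _.
by rewrite [RHS]big_split.
Qed.

Lemma suspensionP (c : seq (seq X)) tau : tau \in suspension c ->
  exists t sg, [/\ (t < N)%N, sg \in c &
    tau \in prism (H t) (H t.+1) sg \/ tau \in prism (H t) (H t.+1) (map T sg)].
Proof.
case/flatten_mapP=> t; rewrite mem_iota /= add0n => tN /flatten_mapP[sg].
rewrite mem_cat => /orP[sgc tausg|/mapP[sg' sgc ->] tausg].
  by exists t, sg; split=> //; left.
by exists t, sg'; split=> //; right.
Qed.

End Suspension.

Lemma map_suspension (X : eqType) N (H H' : nat -> X -> X) (T T' h : X -> X) c :
  (forall t x, h (H t x) = H' t (h x)) -> (forall x, h (T x) = T' (h x)) ->
  map (map h) (suspension N H T c) = suspension N H' T' (map (map h) c).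
Proof.
move=> hH hT; rewrite /suspension map_flatten -map_comp.
congr flatten; apply: eq_map => t /=.
rewrite map_flatten -map_comp.
have -> : map (map h) c ++ map (map T') (map (map h) c) =
    map (map h) (c ++ map (map T) c).
  rewrite map_cat -!map_comp; congr cat; apply: eq_map => sg /=.
  by rewrite -!map_comp; apply: eq_map => x /=.
rewrite -map_comp; congr flatten; apply: eq_map => sg /=.
by rewrite map_prism prism_map; apply: eq_prism => x /=.
Qed.

(** * Products of two hemispheres *)

Local Open Scope ring_scope.

Section Cone.
Variables (R : numFieldType) (N : nat).

Definition cone (V : lmodType R) (p : V) (t : nat) (x : V) : V :=
  (1 - t%:R / N%:R) *: x + (t%:R / N%:R) *: p.

Lemma cone0 (V : lmodType R) (p x : V) : cone p 0 x = x.
Proof. by rewrite /cone mul0r subr0 scale1r scale0r addr0. Qed.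

Lemma coneN (V : lmodType R) (p x : V) : (0 < N)%N -> cone p N x = p.
Proof.
move=> N0; rewrite /cone divff ?pnatr_eq0 -?lt0n //.
by rewrite subrr scale0r add0r scale1r.
Qed.

Lemma linear_cone (V W : lmodType R) (g : {linear V -> W}) p t x :
  g (cone p t x) = cone (g p) t (g x).
Proof. by rewrite /cone linearD !linearZZ. Qed.

Lemma coneNN (V : lmodType R) (p : V) t x : - cone p t x = cone (- p) t (- x).
Proof. by rewrite /cone opprD !scalerN. Qed.

End Cone.

Section Cells.
Variables (R : numFieldType) (X V : lmodType R) (N : nat).
Variables (p : nat -> X) (q : nat -> V).

Definition flipx (z : X * V) : X * V := (- z.1, z.2).
Definition flipv (z : X * V) : X * V := (z.1, - z.2).

Definition conex i t (z : X * V) : X * V := (cone N (p i) t z.1, z.2).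
Definition conev (b : V) t (z : X * V) : X * V := (z.1, cone N b t z.2).

(** A subdivided hemisphere of the octahedral sphere with vertices [p 0],
    [- p 0], ..., [p i], [- p i]: its rim is the whole sphere of dimension
    [i - 1], and it is coned off at [p i]. *)
Fixpoint cellx i : seq (seq (X * V)) :=
  if i is i'.+1 then suspension N (conex i) flipx (cellx i')
  else [:: [:: (p 0, q 0)]].

(** The product of the hemispheres of dimensions [i] and [j], subdivided.  It is
    grown in the second factor from [cellx i] times the point [q 0], so that
    no product of simplices has to be triangulated. *)
Fixpoint cell i j : seq (seq (X * V)) :=
  if j is j'.+1 then suspension N (conev (q j)) flipv (cell i j')
  else cellx i.

Lemma cellS0 i : cell i.+1 0 = suspension N (conex i.+1) flipx (cell i 0).
Proof. by []. Qed.

Lemma cellS i j : cell i j.+1 = suspension N (conev (q j.+1)) flipv (cell i j).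
Proof. by []. Qed.

Lemma flipxK : involutive flipx.
Proof. by case=> x v; rewrite /flipx /= opprK. Qed.

Lemma flipvK : involutive flipv.
Proof. by case=> x v; rewrite /flipv /= opprK. Qed.

Lemma size_cell i j sg : sg \in cell i j -> size sg = (i + j).+1.
Proof.
elim: j sg => [|j IH] sg /=.
  rewrite addn0; elim: i sg => [|i IH] sg /=; first by rewrite inE => /eqP ->.
  case/suspensionP=> t [tau [_ /IH st]].
  by case=> /size_prism ->; rewrite ?size_map st.
case/suspensionP=> t [tau [_ /IH st]].
by case=> /size_prism ->; rewrite ?size_map st addnS.
Qed.

Hypothesis N0 : (0 < N)%N.

Lemma boundary_suspx phi i c :
  pairing phi (boundary (suspension N (conex i) flipx c)) =
  (pairing phi c (+) pairing phi (map (map flipx) c))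
  (+) pairing (suspension_dual N (conex i) flipx phi) (boundary c).
Proof.
apply: boundary_suspension => [[x v]|[x v]].
  by rewrite /conex cone0.
by rewrite /conex /= !coneN.
Qed.

Lemma boundary_suspv phi b c :
  pairing phi (boundary (suspension N (conev b) flipv c)) =
  (pairing phi c (+) pairing phi (map (map flipv) c))
  (+) pairing (suspension_dual N (conev b) flipv phi) (boundary c).
Proof.
apply: boundary_suspension => [[x v]|[x v]].
  by rewrite /conev cone0.
by rewrite /conev /= !coneN.
Qed.

(** The value of [phi] on the chain [(1 + T) c]. *)
Definition pairing_sym (T : X * V -> X * V) phi c : bool :=
  pairing phi c (+) pairing phi (map (map T) c).

(** Suspending [(1 + T) c] gives zero, as [(1 + T)] squares to zero. *)
Lemma pairing_sym_suspension_dual H T phi c : involutive T ->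
  pairing_sym T (suspension_dual N H T phi) c = false.
Proof.
move=> TK; rewrite /pairing_sym pairing_map.
by rewrite (eq_pairing _ (suspension_dual_invol N H TK phi)) addbb.
Qed.

(** The Leibniz rule for the product of two hemispheres.  The condition on [phi]
    discards the face [[::]] of the vertex [cell 0 0]. *)
Lemma boundary_cell phi i j : phi [::] = false ->
  pairing phi (boundary (cell i j)) =
  (if i is i'.+1 then pairing_sym flipx phi (cell i' j) else false) (+)
  (if j is j'.+1 then pairing_sym flipv phi (cell i j') else false).
Proof.
elim: j phi => [|j IHj] phi phi0.
  rewrite addbF; elim: i phi phi0 => [|i IHi] phi phi0.
    by rewrite /boundary /pairing /= big_seq1.
  rewrite cellS0 boundary_suspx IHi ?suspension_dual_nil //.
  case: i {IHi} => [|i]; rewrite ?addbF ?pairing_sym_suspension_dual ?addbF //.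
  exact: flipxK.
rewrite cellS boundary_suspv addbC.
rewrite IHj ?suspension_dual_nil //.
rewrite [X in (_ (+) X) (+) _ = _](_ : _ = false) ?addbF; last first.
  by case: j {IHj} => // j; apply: pairing_sym_suspension_dual; exact: flipvK.
congr (_ (+) _); case: i {IHj} => // i.
rewrite /pairing_sym -!pairing_suspension.
by rewrite -(@map_suspension _ N (conev (q j.+1)) (conev (q j.+1)) flipv flipv).
Qed.

Section Reflection.
Variables (k : nat) (r : {linear V -> V}).
Hypothesis r_fix : forall j, (j < k)%N -> r (q j) = q j.
Hypothesis r_opp : r (q k) = - q k.

Definition reflv (z : X * V) : X * V := (z.1, r z.2).

(** On [cellx i] the second coordinate is constantly [q 0]. *)
Lemma map_cellx_fiber (g g' : V -> V) i : g (q 0) = g' (q 0) ->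
  map (map (fun z : X * V => (z.1, g z.2))) (cellx i) =
  map (map (fun z : X * V => (z.1, g' z.2))) (cellx i).
Proof.
move=> gg'; elim: i => [|i IH] /=; first by rewrite gg'.
have M (h : V -> V) := @map_suspension _ N (conex i.+1) (conex i.+1) flipx flipx
   (fun z : X * V => (z.1, h z.2)).
by rewrite !M // IH.
Qed.

Lemma reflv_cell i j : (j < k)%N -> map (map reflv) (cell i j) = cell i j.
Proof.
elim: j => [|j IH] jk.
  rewrite (@map_cellx_fiber r id i) ?r_fix //.
  rewrite -[RHS]map_id; apply: eq_map => sg.
  by rewrite -[RHS]map_id; apply: eq_map => -[].
rewrite /= (@map_suspension _ N _ (conev (q j.+1)) _ flipv).
- by rewrite IH // ltnW.
- by move=> t [x v]; rewrite /reflv /conev /= linear_cone r_fix.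
- by move=> [x v]; rewrite /reflv /flipv /= linearN.
Qed.

(** Both the reflection and the antipodal map send the top hemisphere to the
    opposite one, since on its rim the reflection is the identity and the
    antipodal map only permutes the two halves. *)
Lemma pairing_reflv_cell phi i :
  pairing phi (map (map reflv) (cell i k)) =
  pairing phi (map (map flipv) (cell i k)).
Proof.
case: k r_fix r_opp reflv_cell => [|m] rf ro rc.
  by congr pairing; apply: map_cellx_fiber.
rewrite /= (@map_suspension _ N _ (conev (- q m.+1)) _ flipv); last 2 first.
- by move=> t [x v]; rewrite /reflv /conev /= linear_cone ro.
- by move=> [x v]; rewrite /reflv /flipv /= linearN.
rewrite rc //.
have flip_conev t z :
    flipv (conev (q m.+1) t z) = conev (- q m.+1) t (flipv z).
  by rewrite /flipv /conev /= coneNN.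
rewrite [in RHS](@map_suspension _ N _ (conev (- q m.+1)) _ flipv) //.
rewrite !pairing_suspension pairing_map; apply: eq_pairing => sg /=.
by rewrite suspension_dual_invol //; exact: flipvK.
Qed.

End Reflection.
End Cells.

(** * The cup product of sign cochains and its parity *)

Section CupProduct.
Variables (Z : eqType) (s : nat -> Z -> bool).

(** On a simplex of dimension [m] this is the cup product of the coboundaries of
    [s (m-1)], ..., [s 0], in this order; the one attached to an edge is found
    by counting the vertices that follow it. *)
Fixpoint cup (sg : seq Z) : bool :=
  if sg is v :: sg' then
    if sg' is w :: sg'' then (s (size sg'') v (+) s (size sg'') w) && cup sg'
    else true
  else true.

(** The cup product of [s m] with [cup], on simplices of dimension [m]. *)
Definition primitive (sg : seq Z) : bool :=
  if sg is v :: sg' then s (size sg') v && cup sg else false.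

Lemma cup_cons2 v w sg :
  cup (v :: w :: sg) = (s (size sg) v (+) s (size sg) w) && cup (w :: sg).
Proof. by []. Qed.

(** This says that [cup] is a cocycle, with the face opposite to [v] moved to
    the right-hand side. *)
Lemma sum_faces_cup_cons v w sg :
  pairing (cup \o cons v) (faces (w :: sg)) = cup (w :: sg).
Proof.
elim: sg v w => [|u sg IH] v w; first by rewrite /pairing /= big_seq1.
rewrite faces_cons pairing_cons pairing_map /=.
have -> : pairing ((cup \o cons v) \o cons w) (faces (u :: sg)) =
    (s (size sg) v (+) s (size sg) w) && cup (u :: sg).
  rewrite -(IH w) [RHS]big_distrr /=; apply: eq_big_seq => f /size_faces.
  by case=> sf; rewrite [LHS]cup_cons2 sf.
rewrite -/(cup (u :: sg)) -andb_addl.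
by case: (s _ v) (s _ w) (s _ u) => -[] [].
Qed.

Lemma coboundary_primitive sg : (1 < size sg)%N ->
  pairing primitive (faces sg) = cup sg.
Proof.
case: sg => [//|v [//|w sg]] _.
rewrite faces_cons pairing_cons pairing_map.
have -> : pairing (primitive \o cons v) (faces (w :: sg)) =
    s (size sg) v && cup (w :: sg).
  rewrite -(sum_faces_cup_cons v) [RHS]big_distrr /=.
  by apply: eq_big_seq => f /size_faces [sf]; rewrite /= sf.
by rewrite cup_cons2 [primitive _]/(_ && _) -andb_addl addbC.
Qed.

Lemma cup_compl (f : Z -> Z) sg :
  (forall z, z \in sg -> forall a, s a (f z) = ~~ s a z) ->
  cup (map f sg) = cup sg.
Proof.
elim: sg => // v [//|w sg] IH sf.
rewrite !map_cons cup_cons2 -map_cons IH => [|z zs]; last first.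
  by apply: sf; rewrite inE zs orbT.
rewrite cup_cons2 size_map !sf ?inE ?eqxx ?orbT //.
by rewrite addNb addbN negbK.
Qed.

(** Complementing [s m] adds [cup] to the cup product of [s m] with [cup], while
    coboundaries do not see the complement. *)
Lemma primitive_compl (f : Z -> Z) sg : sg != [::] ->
  (forall z, z \in sg -> forall a, s a (f z) = ~~ s a z) ->
  primitive sg (+) primitive (map f sg) = cup sg.
Proof.
case: sg => // v sg _ sf; have := cup_compl sf.
rewrite /primitive map_cons => ->.
by rewrite size_map sf ?mem_head // -andb_addl addbN addbb.
Qed.

Lemma cup_const a sg : (a < (size sg).-1)%N ->
  (forall y z, y \in sg -> z \in sg -> s a y = s a z) -> cup sg = false.
Proof.
elim: sg => // v [//|w sg] IH /= + sa.
rewrite ltnS leq_eqVlt => /predU1P[ea|lta].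
  by rewrite -ea (sa v w) ?inE ?eqxx ?orbT // addbb.
rewrite -/(cup (w :: sg)) IH ?andbF // => y z ys zs.
by apply: sa; rewrite inE ?ys ?zs orbT.
Qed.

End CupProduct.

Section Parity.
Variables (R : numFieldType) (X V : lmodType R) (N : nat).
Variables (p : nat -> X) (q : nat -> V) (n k : nat) (r : {linear V -> V}).
Hypothesis N0 : (0 < N)%N.
Hypothesis r_fix : forall j, (j < k)%N -> r (q j) = q j.
Hypothesis r_opp : r (q k) = - q k.
Variable s : nat -> X * V -> bool.
Hypothesis s_flipv : forall i j sg z a, (i <= n)%N -> (j <= k)%N ->
  sg \in cell N p q i j -> z \in sg -> s a (flipv z) = ~~ s a z.
Hypothesis s_flipx : forall z a, s a (flipx z) = s a (reflv r z).

Let cell := cell N p q.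

Lemma pairing_sym_flipv_primitive i j : (i <= n)%N -> (j <= k)%N ->
  pairing_sym (@flipv R X V) (primitive s) (cell i j) =
  pairing (cup s) (cell i j).
Proof.
move=> le_in le_jk; rewrite /pairing_sym pairing_map -pairing_addb.
apply: eq_big_seq => sg sgc; apply: primitive_compl => [|z zs a].
  by rewrite -size_eq0 (size_cell sgc).
exact: s_flipv sgc zs.
Qed.

Lemma primitive_flipx sg :
  primitive s (map (@flipx R X V) sg) = primitive s (map (reflv r) sg).
Proof.
have cupE : cup s (map (@flipx R X V) sg) = cup s (map (reflv r) sg).
  elim: sg => // v [//|w sg] IH.
  by rewrite !map_cons !cup_cons2 !size_map !s_flipx -!map_cons IH.
case: sg cupE => // v sg; rewrite !map_cons /primitive => ->.
by rewrite !size_map s_flipx.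
Qed.

Lemma pairing_sym_flipx_primitive i j : (i <= n)%N -> (j <= k)%N ->
  pairing_sym (@flipx R X V) (primitive s) (cell i j) =
  (j == k) && pairing (cup s) (cell i j).
Proof.
move=> le_in le_jk.
have E : pairing_sym (@flipx R X V) (primitive s) (cell i j) =
         pairing_sym (reflv r) (primitive s) (cell i j).
  rewrite /pairing_sym !pairing_map; congr addb.
  by apply: eq_pairing => sg; rewrite /= primitive_flipx.
rewrite E; move: le_jk; rewrite leq_eqVlt => /predU1P[jk|ltjk].
  rewrite jk eqxx -pairing_sym_flipv_primitive // /pairing_sym.
  by rewrite (pairing_reflv_cell _ _ r_fix r_opp).
by rewrite ltn_eqF // /pairing_sym (reflv_cell _ _ r_fix) // addbb.
Qed.

(** The recursion [rec] combines [boundary_cell] with the two symmetries of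
    the signs.  In the hemisphere [cell i j] with [j < k] only the term lowering
    [j] survives, down to [cell i 0], which gives 1 exactly when [i = 0]; for
    [j = k] the term lowering [i] survives as well. *)
Theorem parity_cell i j : (i <= n)%N -> (j <= k)%N ->
  pairing (cup s) (cell i j) = (i == 0) || (j == k).
Proof.
have rec a b : (a <= n)%N -> (b <= k)%N -> (0 < a + b)%N ->
    pairing (cup s) (cell a b) =
    (if a is a'.+1 then (b == k) && pairing (cup s) (cell a' b) else false) (+)
    (if b is b'.+1 then pairing (cup s) (cell a b') else false).
  move=> an bk ab.
  have -> : pairing (cup s) (cell a b) =
      pairing (primitive s) (boundary (cell a b)).
    rewrite pairing_boundary; apply: eq_big_seq => sg /size_cell ss.
    by rewrite coboundary_primitive // ss.
  rewrite boundary_cell //.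
  congr addb.
    by case: a an {ab} => // a an; rewrite pairing_sym_flipx_primitive // ltnW.
  by case: b bk {ab} => // b bk; rewrite pairing_sym_flipv_primitive // ltnW.
elim: j i => [|j IHj]; elim=> [|i IHi] lin ljk.
- by rewrite /pairing /= big_seq1.
- rewrite rec // IHi ?(ltnW lin) // addbF andb_orr andbb /=.
  by case: (_ == k); rewrite ?orbT ?andbF.
- by rewrite rec // IHj ?(ltnW ljk).
- rewrite rec // IHi ?(ltnW lin) // IHj ?(ltnW ljk) //.
  rewrite (ltn_eqF ljk) orbF addbF /=.
  by case: (i == 0); case: (_ == k).
Qed.

End Parity.

(** * Position and mesh of the subdivided hemispheres *)

Section Octahedron.
Variables (R : realFieldType) (N : nat).
Hypothesis N0 : (0 < N)%N.

Definition pole d j : 'rV[R]_d := \row_a (a == j :> nat)%:R.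

(** The unit sphere of the sum norm: a segment from a point of it to a pole
    orthogonal to that point stays on it, so that no normalization enters the
    cones. *)
Definition octahedron d (x : 'rV[R]_d) : Prop := \sum_a `|x 0 a| = 1.

Definition octahedral d j (x : 'rV[R]_d) : Prop :=
  octahedron x /\ forall a : 'I_d, (j < a)%N -> x 0 a = 0.

Definition close d (mu : R) (x y : 'rV[R]_d) : Prop :=
  forall a, `|x 0 a - y 0 a| <= mu.

Lemma ratio_itv t : (t <= N)%N -> 0 <= (t%:R / N%:R : R) <= 1.
Proof.
move=> tN; rewrite divr_ge0 ?ler0n //=.
by rewrite ler_pdivrMr ?ltr0n // mul1r ler_nat.
Qed.

Lemma octahedral_pole d j : (j < d)%N -> octahedral j (pole d j).
Proof.
move=> jd; split=> [|a ja]; last by rewrite mxE gtn_eqF.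
rewrite /octahedron (bigD1 (Ordinal jd)) //= mxE eqxx normr1.
rewrite big1 ?addr0 // => a aj.
by rewrite mxE -(inj_eq val_inj) /= in aj *; rewrite (negPf aj) normr0.
Qed.

Lemma octahedral_opp d j (x : 'rV[R]_d) : octahedral j x -> octahedral j (- x).
Proof.
case=> x1 xj; split=> [|a ja]; last by rewrite mxE xj ?oppr0.
by rewrite /octahedron -[RHS]x1; apply: eq_bigr => a _; rewrite mxE normrN.
Qed.

Lemma octahedral_cone d j t (x : 'rV[R]_d) : (j.+1 < d)%N -> (t <= N)%N ->
  octahedral j x -> octahedral j.+1 (cone N (pole d j.+1) t x).
Proof.
move=> jd /ratio_itv /andP[t0 t1] [x1 xj]; split=> [|a ja]; last first.
  by rewrite !mxE gtn_eqF // xj 1?ltnW // !mulr0 addr0.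
have [p1 _] := octahedral_pole jd.
have t1' : 0 <= 1 - t%:R / N%:R :> R by lra.
transitivity (\sum_a ((1 - t%:R / N%:R) * `|x 0 a| +
     t%:R / N%:R * `|pole d j.+1 0 a|)).
  apply: eq_bigr => a _; rewrite !mxE; case: eqP => [aj|_].
    by rewrite xj ?aj // normr0 !mulr0 !add0r normrM normr1 ger0_norm.
  by rewrite normr0 !mulr0 !addr0 normrM ger0_norm.
by rewrite big_split /= -!mulr_sumr x1 p1 !mulr1 subrK.
Qed.

Lemma octahedron_le1 d (x : 'rV[R]_d) a : octahedron x -> `|x 0 a| <= 1.
Proof.
by move=> <-; rewrite (bigD1 a) //= lerDl sumr_ge0.
Qed.

Lemma octahedron_neq0 d (x : 'rV[R]_d) : octahedron x -> x != 0.
Proof.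
move=> x1; apply/eqP => x0; move: x1; rewrite /octahedron big1.
  by move/eqP; rewrite eq_sym oner_eq0.
by move=> a _; rewrite x0 mxE normr0.
Qed.

Lemma close_opp d mu (x y : 'rV[R]_d) : close mu x y -> close mu (- x) (- y).
Proof. by move=> xy a; rewrite !mxE -opprD normrN. Qed.

(** The increment is the largest displacement between two consecutive stages:
    [1 / N] times the diameter 2 of the range of a coordinate. *)
Lemma close_cone d mu (p x y : 'rV[R]_d) t u u' : (t < N)%N ->
  u = t \/ u = t.+1 -> u' = t \/ u' = t.+1 ->
  octahedron p -> octahedron y -> close mu x y ->
  close (mu + 2 / N%:R) (cone N p u x) (cone N p u' y).
Proof.
move=> tN ut ut' /octahedron_le1 p1 /octahedron_le1 y1 xy a; rewrite !mxE.
have /ratio_itv uN : (u <= N)%N by case: ut => ->; rewrite // ltnW.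
have uu' : `|u'%:R / N%:R - u%:R / N%:R| <= 1 / N%:R :> R.
  rewrite -mulrBl normrM [X in _ * X]ger0_norm ?invr_ge0 ?ler0n //.
  apply: ler_wpM2r; rewrite ?invr_ge0 ?ler0n //.
  case: ut ut' => -> [] ->; rewrite ?subrr ?normr0 ?ler01 //.
    by rewrite -natr1 [_ + 1]addrC addrK normr1.
  by rewrite -natr1 opprD addNKr normrN normr1.
have := xy a; have := p1 a; have := y1 a; move: uu' uN.
move: (u%:R / _) (u'%:R / _) (x 0 a) (y 0 a) (p 0 a).
move=> m m' X Y P mm' m01 Y1 P1 XY.
have -> : (1 - m) * X + m * P - ((1 - m') * Y + m' * P) =
  (1 - m) * (X - Y) + (m' - m) * (Y - P) by ring.
apply: (le_trans (ler_normD _ _)); apply: lerD; rewrite normrM.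
  rewrite -[leRHS]mul1r; apply: ler_pM => //.
  by rewrite ler_norml; lra.
rewrite [2 / _](_ : _ = 1 / N%:R * 2); last by ring.
apply: ler_pM => //; apply: (le_trans (ler_normB _ _)); lra.
Qed.

Section SmallCells.
Variables (a b : nat).

Definition small_in i j (mu : R) (sg : seq ('rV[R]_a * 'rV[R]_b)) : Prop :=
  (forall z, z \in sg -> octahedral i z.1 /\ octahedral j z.2) /\
  (forall y z, y \in sg -> z \in sg -> close mu y.1 z.1 /\ close mu y.2 z.2).

Lemma small_map_flipx i j mu sg :
  small_in i j mu sg -> small_in i j mu (map (@flipx _ _ _) sg).
Proof.
case=> sup cl; split=> [_ /mapP[z zs ->]|_ _ /mapP[y ys ->] /mapP[z zs ->]].
  by have [/octahedral_opp ? ?] := sup z zs.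
by have [/close_opp ? ?] := cl y z ys zs.
Qed.

Lemma small_map_flipv i j mu sg :
  small_in i j mu sg -> small_in i j mu (map (@flipv _ _ _) sg).
Proof.
case=> sup cl; split=> [_ /mapP[z zs ->]|_ _ /mapP[y ys ->] /mapP[z zs ->]].
  by have [? /octahedral_opp ?] := sup z zs.
by have [? /close_opp ?] := cl y z ys zs.
Qed.

Lemma close_le d mu nu (x y : 'rV[R]_d) :
  mu <= nu -> close mu x y -> close nu x y.
Proof. by move=> mn xy e; apply: le_trans mn. Qed.

Lemma small_prism_conex i j mu sg t tau : (i.+1 < a)%N -> (t < N)%N ->
  small_in i j mu sg ->
  tau \in prism (conex N (pole a) i.+1 t) (conex N (pole a) i.+1 t.+1) sg ->
  small_in i.+1 j (mu + 2 / N%:R) tau.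
Proof.
move=> ia tN [sup cl] tauP.
have mem z : z \in tau -> exists2 x, x \in sg & exists2 u, u = t \/ u = t.+1 &
    z = conex N (pole a) i.+1 u x.
  by case/(mem_prism tauP) => x xs [->|->]; exists x => //;
    [exists t|exists t.+1]; auto.
split=> [z /mem[x xs [u ut ->]]|
         y z /mem[x xs [u ut ->]] /mem[x' xs' [u' ut' ->]]].
  have [x1 x2] := sup x xs; split=> //; apply: octahedral_cone => //.
  by case: ut => ->; rewrite // ltnW.
have [x1 x2] := cl x x' xs xs'; have [ox' _] := sup x' xs'; split.
  by apply: close_cone tN ut ut' (octahedral_pole ia).1 ox'.1 x1.
by apply: close_le x2; rewrite lerDl divr_ge0.
Qed.

Lemma small_prism_conev i j mu sg t tau : (j.+1 < b)%N -> (t < N)%N ->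
  small_in i j mu sg ->
  tau \in prism (conev N (pole b j.+1) t) (conev N (pole b j.+1) t.+1) sg ->
  small_in i j.+1 (mu + 2 / N%:R) tau.
Proof.
move=> jb tN [sup cl] tauP.
have mem z : z \in tau -> exists2 x, x \in sg & exists2 u, u = t \/ u = t.+1 &
    z = conev N (pole b j.+1) u x.
  by case/(mem_prism tauP) => x xs [->|->]; exists x => //;
    [exists t|exists t.+1]; auto.
split=> [z /mem[x xs [u ut ->]]|
         y z /mem[x xs [u ut ->]] /mem[x' xs' [u' ut' ->]]].
  have [x1 x2] := sup x xs; split=> //; apply: octahedral_cone => //.
  by case: ut => ->; rewrite // ltnW.
have [x1 x2] := cl x x' xs xs'; have [_ ox'] := sup x' xs'; split.
  by apply: close_le x1; rewrite lerDl divr_ge0.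
by apply: close_cone tN ut ut' (octahedral_pole jb).1 ox'.1 x2.
Qed.

Lemma small_cell i j sg : (i < a)%N -> (j < b)%N ->
  sg \in cell N (pole a) (pole b) i j ->
  small_in i j ((i + j)%:R * (2 / N%:R)) sg.
Proof.
move=> ia; elim: j sg => [|j IHj] sg jb.
  rewrite addn0 /=; elim: i ia sg => [|i IHi] ia sg.
    rewrite inE => /eqP ->; split=> [z|y z]; rewrite !inE.
      by move=> /eqP ->; split; exact: octahedral_pole.
    by move=> /eqP -> /eqP ->; split=> e; rewrite subrr normr0 mul0r.
  case/suspensionP=> t [tau [tN /(IHi (ltnW ia)) st]].
  rewrite -natr1 mulrDl mul1r.
  by case=> /small_prism_conex; apply => //; exact: small_map_flipx.
case/suspensionP=> t [tau [tN /IHj -/(_ (ltnW jb)) st]].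
rewrite addnS -natr1 mulrDl mul1r.
by case=> /small_prism_conev; apply => //; exact: small_map_flipv.
Qed.

End SmallCells.
End Octahedron.

(** * Zeros of equivariant maps *)

Local Open Scope classical_set_scope.
Local Open Scope ring_scope.

Section CoordinateSign.
Variables (R : realFieldType) (m : nat).

(** The choice made when the coordinate [a] vanishes depends only on which
    coordinates vanish, so that the sign below changes under [y -> - y] for all
    nonzero [y]. *)
Definition pick_coord (y : 'rV[R]_m) (a : nat) : option 'I_m :=
  if [pick i : 'I_m | (i == a :> nat) && (y 0 i != 0)] is Some i then Some i
  else [pick i | y 0 i != 0].

Definition coord_sign (a : nat) (y : 'rV[R]_m) : bool :=
  if pick_coord y a is Some i then 0 < y 0 i else false.

Lemma coord_sign_opp a (y : 'rV[R]_m) :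
  y != 0 -> coord_sign a (- y) = ~~ coord_sign a y.
Proof.
move=> y0; have opp0 i : ((- y) 0 i != 0) = (y 0 i != 0).
  by rewrite mxE oppr_eq0.
have pick_opp : pick_coord (- y) a = pick_coord y a.
  have e1 : [pick i : 'I_m | (i == a :> nat) && ((- y) 0 i != 0)] =
      [pick i : 'I_m | (i == a :> nat) && (y 0 i != 0)].
    by apply: eq_pick => i; rewrite opp0.
  have e2 : [pick i | (- y) 0 i != 0] = [pick i | y 0 i != 0].
    by apply: eq_pick => i; rewrite opp0.
  by rewrite /pick_coord e1 e2.
rewrite /coord_sign pick_opp /pick_coord.
suff sgn_opp i : y 0 i != 0 -> (0 < (- y) 0 i) = ~~ (0 < y 0 i).
  case: pickP => [i /andP[_ /sgn_opp //]|_].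
  case: pickP => [i /sgn_opp //|yz].
  case/eqP: y0; apply/rowP => i; rewrite mxE; apply/eqP.
  by have /negbFE := yz i.
by move=> yi; rewrite mxE oppr_gt0 -leNgt le_eqVlt (negPf yi).
Qed.

Lemma coord_signE (i : 'I_m) (y : 'rV[R]_m) :
  y 0 i != 0 -> coord_sign i y = (0 < y 0 i).
Proof.
move=> yi; rewrite /coord_sign /pick_coord.
case: pickP => [j /andP[/eqP/val_inj -> _]//|/(_ i)].
by rewrite eqxx yi.
Qed.

End CoordinateSign.

Section Compactness.
Variable R : realType.

Lemma octahedron_continuous d :
  continuous (fun x : 'rV[R]_d => \sum_a `|x 0 a|).
Proof.
apply: continuous_big => [|a _ x]; first exact: add_continuous.
apply: (@continuous_comp _ _ _ (fun x : 'rV[R]_d => x 0 a) Num.norm).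
  exact: (@coord_continuous R 1 d 0 a).
exact: norm_continuous.
Qed.

Lemma compact_octahedron d : compact [set x : 'rV[R]_d | octahedron x].
Proof.
apply: bounded_closed_compact.
  exists 1; split=> // M M1 x x1; apply: le_trans (ltW M1).
  rewrite [leLHS]/Num.norm /= mx_normrE.
  apply/bigmax_leP; split=> //= -[i j] _ /=.
  by rewrite ord1; exact: octahedron_le1.
rewrite (_ : [set x | _] =
  (fun x : 'rV[R]_d => \sum_a `|x 0 a|) @^-1` [set 1]) //.
apply: preimage_closed => [x _|]; first exact: octahedron_continuous.
exact: closed_eq.
Qed.

Definition octahedra (a b : nat) : set ('rV[R]_a * 'rV[R]_b) :=
  [set z | octahedron z.1 /\ octahedron z.2].

Lemma compact_octahedra a b : compact (@octahedra a b).
Proof. by apply: compact_setX; exact: compact_octahedron. Qed.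

(** A Lebesgue number for the cover of the product of the two spheres by the
    open sets where one coordinate of [F] is nonzero. *)
Lemma uniform_sign a b m (F : 'rV[R]_a * 'rV[R]_b -> 'rV[R]_m) :
  (forall z, octahedra z -> {for z, continuous F}) ->
  (forall z, octahedra z -> F z != 0) ->
  exists2 eta : R, 0 < eta & forall y, octahedra y -> exists i : 'I_m,
    forall z, octahedra z -> ball y eta z -> 0 < F y 0 i * F z 0 i.
Proof.
move=> Fc F0.
pose P (eta : R) y := exists i : 'I_m, forall z, octahedra z -> ball y eta z ->
  0 < F y 0 i * F z 0 i.
suff covered : \forall eta \near 0^'+, @octahedra a b `<=` P eta.
  have [eta [eta0 etaP]] := filter_ex (filterI (nbhs_right_gt 0) covered).
  by exists eta.
have /compact_near_coveringP/near_covering_withinP := @compact_octahedra a b.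
apply=> x Kx; have /rV0Pn[i ci] := F0 x Kx.
have : \forall z \near x, 0 < F x 0 i * F z 0 i.
  have Fi : F z 0 i @[z --> x] --> F x 0 i.
    apply: (@continuous_comp _ _ _ F (fun y : 'rV[R]_m => y 0 i)).
      exact: Fc.
    exact: coord_continuous.
  have FF : F x 0 i * F z 0 i @[z --> x] --> F x 0 i * F x 0 i by exact: cvgMr.
  by apply: (cvgr_gt _ FF); rewrite -expr2 exprn_even_gt0.
move=> /nbhs_ballP[e /= e0 eP].
exists (ball x (e / 2), [set t | t < e / 2]).
  by split; [apply: nbhsx_ballx|apply: nbhs_right_lt]; rewrite divr_gt0.
move=> [y t] [/= xy te] _; exists i => z _ yz.
have c0 : 0 < F x 0 i * F y 0 i.
  apply: eP; apply: le_ball xy.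
  by rewrite ler_pdivrMr // ler_peMr ?ler1n // ltW.
have c1 : 0 < F x 0 i * F z 0 i.
  by apply: eP; apply: (ball_split xy); apply: le_ball yz; exact: ltW.
have := mulr_gt0 c0 c1; rewrite mulrACA -expr2 pmulr_rgt0 //.
by rewrite exprn_even_gt0.
Qed.

Definition reflect_last k : 'M[R]_(k + 1) := block_mx 1%:M 0 0 (- 1%:M).

Lemma pole_reflect_last k j : (j < k)%N ->
  pole R (k + 1) j *m reflect_last k = pole R (k + 1) j.
Proof.
move=> jk; have -> : pole R (k + 1) j = row_mx (pole R k j) 0.
  apply/rowP => a; rewrite !mxE; case: splitP => b ->; first by rewrite mxE.
  by rewrite mxE ord1 addn0 gtn_eqF.
by rewrite mul_row_block !mulmx0 mul0mx mulmx1 !addr0.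
Qed.

Lemma pole_reflect_last_max k :
  pole R (k + 1) k *m reflect_last k = - pole R (k + 1) k.
Proof.
have -> : pole R (k + 1) k = row_mx 0 1%:M.
  apply/rowP => a; rewrite !mxE; case: splitP => b ->.
    by rewrite mxE ltn_eqF.
  by rewrite mxE !ord1 addn0 !eqxx.
by rewrite mul_row_block !mul0mx mulmx0 mul1mx !add0r opp_row_mx oppr0. 
Qed.

(** For [k = 0] this is the Borsuk-Ulam theorem for maps to [R^n].  Were there
    no zero, take a subdivision finer than the Lebesgue number: [parity_cell]
    yields a simplex on which [cup] is true, hence on which the sign of every
    coordinate varies, against [uniform_sign]. *)
Theorem exists_equivariant_zero n k m
    (F : 'rV[R]_n.+1 * 'rV[R]_(k + 1) -> 'rV[R]_m) : (m <= n + k)%N ->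
  (forall z, z.1 != 0 -> z.2 != 0 -> {for z, continuous F}) ->
  (forall x v, F (x, - v) = - F (x, v)) ->
  (forall x v, F (- x, v) = F (x, v *m reflect_last k)) ->
  exists z, [/\ z.1 != 0, z.2 != 0 & F z = 0].
Proof.
move=> mnk Fc Fv Fx; apply: contrapT => noz.
have oct0 z : octahedra z -> z.1 != 0 /\ z.2 != 0.
  by case=> /octahedron_neq0 ? /octahedron_neq0.
have F0 z : octahedra z -> F z != 0.
  by move=> /oct0[z1 z2]; apply/eqP => Fz; apply: noz; exists z.
have [|eta eta0 etaP] := uniform_sign _ F0.
  by move=> z /oct0[]; exact: Fc.
(* [cell n k] arises from a vertex by [n + k] suspensions, each of which
   increases the mesh by at most [2 / N]. *)
pose N := (Num.bound ((n + k)%:R * 2 / eta)).+1.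
have N0 : (0 < N)%N by [].
have meshN : (n + k)%:R * (2 / N%:R) < eta.
  rewrite mulrA ltr_pdivrMr ?ltr0n // [eta * _]mulrC -ltr_pdivrMr //.
  apply: lt_le_trans (archi_boundP _) _; last by rewrite ler_nat.
  by rewrite divr_ge0 ?mulr_ge0 // ltW.
pose s a z := coord_sign a (F z).
have sup i j sg : (i <= n)%N -> (j <= k)%N ->
    sg \in cell N (pole R n.+1) (pole R (k + 1)) i j ->
    small_in i j ((i + j)%:R * (2 / N%:R)) sg.
  by move=> lin ljk; apply: small_cell; rewrite ?addn1.
have par : pairing (cup s) (cell N (pole R n.+1) (pole R (k + 1)) n k) = true.
  rewrite (@parity_cell _ _ _ N _ _ n k (mulmxr (reflect_last k)));
    rewrite ?eqxx ?orbT //.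
  - by move=> j; exact: pole_reflect_last.
  - exact: pole_reflect_last_max.
  - move=> i j sg [x v] a lin ljk /(sup _ _ _ lin ljk)[oz _] /oz[[x1 _] [v1 _]].
    by rewrite /s /flipv /= Fv coord_sign_opp // F0.
  - by move=> [x v] a; rewrite /s /flipx /reflv /= Fx.
have [sg sgc] : exists2 sg,
    sg \in cell N (pole R n.+1) (pole R (k + 1)) n k & cup s sg.
  apply: contrapT => nocup.
  move: par; rewrite /pairing big1_seq // => sg /= sgc.
  by apply/negP => cupsg; apply: nocup; exists sg.
have [oz cl] := sup _ _ _ (leqnn n) (leqnn k) sgc.
have octs z : z \in sg -> octahedra z by move=> /oz[[z1 _] [z2 _]].
have ss := size_cell sgc.
have [y ys] : exists y, y \in sg.
  by case: sg ss {sgc oz cl octs} => // y sg _; exists y; exact: mem_head.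
have [i iP] := etaP y (octs y ys).
have iP' z : z \in sg -> 0 < F y 0 i * F z 0 i.
  move=> zs; apply: iP; first exact: octs.
  have [c1 c2] := cl y z ys zs.
  by split; split=> // o b; rewrite !ord1; apply: le_lt_trans meshN.
rewrite (@cup_const _ s i) // ?ss ?(leq_trans (ltn_ord i)) // => z w zs ws.
have := iP' z zs; have := iP' w ws; rewrite /s.
have [Fy|Fy|->] := ltrgt0P (F y 0 i); last by rewrite mul0r ltxx.
  rewrite !pmulr_rgt0 // => Fw Fz.
  by rewrite !coord_signE ?gt_eqF // Fw Fz.
rewrite !nmulr_rgt0 // => Fw Fz.
by rewrite !coord_signE ?lt_eqF // (lt_gtF Fw) (lt_gtF Fz).
Qed.

End Compactness.

(** * Families of planes in the Grassmannian *)

Local Open Scope quotient_scope.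

Section MatrixConvergence.
Variables (R : realType) (T : Type) (F : set_system T).
Context {FF : Filter F}.

Lemma mx_cvg m n (f : T -> 'M[R]_(m, n)) (A : 'M[R]_(m, n)) :
  (forall i j, f z i j @[z --> F] --> A i j) -> f z @[z --> F] --> A.
Proof.
move=> fA; apply/cvg_ballP => e e0.
have : \forall z \near F, forall i, forall j, ball (A i j) e (f z i j).
  apply: filter_forall => i; apply: filter_forall => j.
  by move/cvg_ballP: (fA i j); apply.
by apply: filterS => z; split.
Qed.

Lemma mulmx_cvg m n p (f : T -> 'M[R]_(m, n)) (g : T -> 'M[R]_(n, p))
    (A : 'M[R]_(m, n)) (B : 'M[R]_(n, p)) :
  f z @[z --> F] --> A -> g z @[z --> F] --> B ->
  f z *m g z @[z --> F] --> A *m B.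
Proof.
move=> fA gB; apply: mx_cvg => i j; rewrite !mxE.
under eq_cvg do rewrite mxE.
apply: cvg_big => [|a _]; first exact: add_continuous.
apply: cvgM.
  exact: (cvg_comp _ _ fA (@coord_continuous _ _ _ i a A)).
exact: (cvg_comp _ _ gB (@coord_continuous _ _ _ a j B)).
Qed.

Lemma trmx_cvg m n (f : T -> 'M[R]_(m, n)) (A : 'M[R]_(m, n)) :
  f z @[z --> F] --> A -> (f z)^T @[z --> F] --> A^T.
Proof.
move=> fA; apply: mx_cvg => i j; rewrite mxE; under eq_cvg do rewrite mxE.
exact: (cvg_comp _ _ fA (@coord_continuous _ _ _ j i A)).
Qed.

End MatrixConvergence.

Section Frames.
Variables (R : realType) (d l : nat).

Lemma mem_span_frame (A : 'M[R]_(l, d)) w :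
  reflect (exists v : 'rV_l, w = v *m A) (w \in <<frame_rows A>>%VS).
Proof.
have mulE (v : 'rV_l) : v *m A = \sum_i v 0 i *: (frame_rows A)`_i.
  rewrite mulmx_sum_row; apply: eq_bigr => i _.
  by rewrite -tnth_nth tnth_mktuple.
apply: (iffP idP) => [/coord_span ->|[v ->]].
  exists (\row_i coord (frame_rows A) i w); rewrite mulE.
  by apply: eq_bigr => i _; rewrite mxE.
rewrite mulE; apply: memv_suml => i _; apply: memvZ.
by apply: memv_span; apply: mem_nth; rewrite size_tuple.
Qed.

Lemma framesP (A : 'M[R]_(l, d)) :
  (forall v : 'rV_l, v *m A = 0 -> v = 0) -> frames A.
Proof.
move=> injA; apply/freeP => c cA i.
have /rowP/(_ i) : \row_i c i = 0.
  apply: injA; rewrite -[RHS]cA mulmx_sum_row; apply: eq_bigr => j _.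
  by rewrite mxE -tnth_nth tnth_mktuple.
by rewrite !mxE.
Qed.

Lemma gr_space_pi (A : stiefel R d l) :
  gr_space (\pi_(grassmannian R d l) A) = <<frame_rows (set_val A)>>%VS.
Proof. by rewrite /gr_space unlock. Qed.

Lemma grassmannian_eq (L M : grassmannian R d l) :
  gr_space L = gr_space M -> L = M.
Proof. by exact: (val_inj : injective (@subspace_val R d l)). Qed.

Lemma taut_vec_continuous : continuous (@taut_vec R d l).
Proof.
move=> e; apply: (@continuous_comp _ _ _ set_val snd).
  exact: initial_continuous.
exact: cvg_snd.
Qed.

Lemma taut_section_mem (s : grassmannian R d l -> taut_total R d l) L :
  taut_section s -> taut_vec (s L) \in gr_space L.
Proof.
case=> _ /(_ L) sL; rewrite -[X in gr_space X]sL.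
exact: (set_valP (s L)).
Qed.

(** The hyperplane is [p] plus the orthogonal of [w] in the plane; its dimension
    is [l - 1] because [w], having nonzero norm, is not orthogonal to itself. *)
Lemma hyperplane_of_normal (L : grassmannian R d l) (w p : 'rV[R]_d) :
  w \in gr_space L -> w != 0 -> p \in gr_space L ->
  exists2 H, affine_hyperplane_in L H &
    forall y, y \in gr_space L -> (y - p) *m w^T = 0 -> H y.
Proof.
move=> wL w0 pL.
pose f := linfun (mulmxr w^T : 'rV[R]_d -> 'rV[R]_1).
pose V := (gr_space L :&: lker f)%VS.
have fE y : f y = y *m w^T by rewrite lfunE.
exists [set p + v | v in [set v | v \in V]]; last first.
  move=> y yL yp; exists (y - p); last by rewrite addrC subrK.
  by rewrite /= memv_cap memvB // memv_ker fE yp eqxx.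
split=> [_ [v /= + <-]|].
  by rewrite memv_cap => /andP[vL _]; rewrite memvD.
exists p, V; split=> //.
have <- : \dim (gr_space L) = l := eqP (subspace_valP L).
rewrite -(limg_ker_dim f (gr_space L)) [X in (_ + X)%N](_ : _ = 1)%N ?addnK //.
apply/eqP; rewrite eqn_leq; apply/andP; split.
  by apply: leq_trans (dimvS (subvf _)) _; rewrite dimvf /dim /= mul1n.
rewrite lt0n dimv_eq0; apply/eqP => fL0.
have : f w \in (f @: gr_space L)%VS by exact: memv_img.
rewrite fL0 memv0 fE => /eqP/rowP/(_ 0); rewrite !mxE => /eqP.
rewrite psumr_eq0 => [|i _]; last by rewrite mxE -expr2 sqr_ge0.
move=> /allP wz; case/eqP: w0; apply/rowP => i; rewrite mxE.
have := wz i (mem_index_enum _); rewrite mxE -expr2 sqrf_eq0 => /eqP //.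
Qed.

End Frames.

Section ProjectiveFamily.
Variables (R : realType) (k n : nat).
Local Notation d := (k + n.+1)%N.
Local Notation l := (k + 1)%N.

(** The planes [L(x)] spanned by the first [k] coordinate vectors and by [x],
    which lies in the span of the [n + 1] others. *)
Definition frame_mx (x : 'rV[R]_n.+1) : 'M[R]_(l, d) := block_mx 1%:M 0 0 x.

Lemma frame_mx_inj x (v : 'rV[R]_l) : x != 0 -> v *m frame_mx x = 0 -> v = 0.
Proof.
move=> x0; rewrite -(hsubmxK v) mul_row_block !mulmx0 mulmx1 addr0 add0r.
rewrite -[RHS]row_mx0 => /eq_row_mx[-> cx].
suff -> : rsubmx v = 0 by rewrite row_mx0.
apply/rowP => a; rewrite ord1 [RHS]mxE; apply/eqP.
have /rV0Pn[b xb] := x0; have /rowP/(_ b) := cx.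
by rewrite mxE big_ord1 [RHS]mxE => /eqP; rewrite mulf_eq0 (negPf xb) orbF.
Qed.

Lemma frame_mx_frames x : x != 0 -> frames (frame_mx x).
Proof. by move=> x0; apply: framesP => v; exact: frame_mx_inj. Qed.

Lemma frame_mx_continuous : continuous frame_mx.
Proof.
move=> x; apply: (mx_cvg (FF := nbhs_filter x)) => i j.
suff : {for x, continuous (fun y => frame_mx y i j)} by [].
have -> : (fun y => frame_mx y i j) =
    match fintype.split i, fintype.split j with
    | inl a, inl b => fun=> (1%:M : 'M[R]_k) a b
    | inr a, inr b => fun y => y a b
    | _, _ => fun=> 0 end.
  apply/funext => y; rewrite !mxE.
  by case: (fintype.split i) => a; rewrite !mxE;
    case: (fintype.split j) => b; rewrite ?mxE.
case: (fintype.split i) => a; case: (fintype.split j) => b;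
  last exact: coord_continuous.
all: exact: (@cvg_cst _ _ _ (nbhs x)).
Qed.

(** This identity makes [L(-x) = L(x)], and makes the coordinates of a vector of
    this plane in the two frames differ by the reflection. *)
Lemma frame_mxN x : frame_mx (- x) = reflect_last R k *m frame_mx x.
Proof.
by rewrite mulmx_block !mul0mx !mulmx0 !mul1mx mulNmx mul1mx !addr0 add0r.
Qed.

Lemma one_neq0 : (const_mx 1 : 'rV[R]_n.+1) != 0.
Proof. by apply/rV0Pn; exists 0; rewrite mxE oner_neq0. Qed.

(** The value of [frame_of] at [x = 0], where [frame_mx x] is not a frame. *)
Definition std_frame : stiefel R d l :=
  SigSub (mem_set (frame_mx_frames one_neq0)).

Definition frame_of (x : 'rV[R]_n.+1) : stiefel R d l :=
  insubd std_frame (frame_mx x).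

Lemma val_frame_of x : x != 0 -> set_val (frame_of x) = frame_mx x.
Proof.
by move=> x0; apply: insubdK; apply: mem_set; exact: frame_mx_frames.
Qed.

Lemma frame_of_continuous x : x != 0 -> {for x, continuous frame_of}.
Proof.
move=> x0 A [B [[C oC <-] Cx CA]].
have : \forall y \near x, y != 0 by exact: (@cvgr_neq0 _ _ _ (nbhs x) _ id x).
have : \forall y \near x, C (frame_mx y).
  apply: frame_mx_continuous; apply: open_nbhs_nbhs; split=> //.
  by rewrite -val_frame_of.
by apply: filterS2 => y Cy y0; apply: CA; rewrite /preimage /= val_frame_of.
Qed.

Definition plane_of (x : 'rV[R]_n.+1) : grassmannian R d l :=
  \pi_(grassmannian R d l) (frame_of x).

Lemma plane_of_continuous x : x != 0 -> {for x, continuous plane_of}.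
Proof.
move=> x0; apply: (@continuous_comp _ _ _ frame_of).
  exact: frame_of_continuous.
exact: pi_continuous.
Qed.

Lemma mem_plane_of x w : x != 0 ->
  reflect (exists v : 'rV_l, w = v *m frame_mx x) (w \in gr_space (plane_of x)).
Proof.
by move=> x0; rewrite gr_space_pi val_frame_of //; exact: mem_span_frame.
Qed.

Lemma plane_ofN x : plane_of (- x) = plane_of x.
Proof.
have [->|x0] := eqVneq x 0; first by rewrite oppr0.
apply: grassmannian_eq; apply/vspaceP => w.
apply/mem_plane_of/mem_plane_of; rewrite ?oppr_eq0 // => -[v ->].
  by exists (v *m reflect_last R k); rewrite frame_mxN mulmxA.
by exists (v *m reflect_last R k); rewrite -mulmxA -frame_mxN opprK.
Qed.

(** The main statement in the coordinates [l = k + 1], [d = k + (n + 1)] of the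
    family of planes [plane_of]. *)
Theorem sections_in_hyperplane
    (s : 'I_d -> grassmannian R d l -> taut_total R d l) :
  (forall i, taut_section (s i)) ->
  exists (L : grassmannian R d l) (H : set 'rV[R]_d),
    affine_hyperplane_in L H /\ forall i, H (taut_vec (s i L)).
Proof.
move=> hs; pose t i x := taut_vec (s i (plane_of x)).
pose last : 'I_d := rshift k ord_max.
have le_d : (k + n <= d)%N by rewrite leq_add2l.
pose F (z : 'rV[R]_n.+1 * 'rV[R]_l) : 'rV[R]_(k + n) := \row_i
  ((t (widen_ord le_d i) z.1 - t last z.1) *m (z.2 *m frame_mx z.1)^T) 0 0.
have tc i x : x != 0 -> {for x, continuous (t i)}.
  move=> x0.
  apply: (@continuous_comp _ _ _ plane_of (fun L => taut_vec (s i L))).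
    exact: plane_of_continuous.
  apply: (@continuous_comp _ _ _ (s i) (@taut_vec R d l)).
    exact: (hs i).1.
  exact: taut_vec_continuous.
have [||x v|x v|z [z1 z2 Fz]] := @exists_equivariant_zero R n k _ F.
- by rewrite addnC.
- move=> [x v] /= x0 _; apply: (mx_cvg (FF := nbhs_filter (x, v))) => o i.
  have fstc : z.1 @[z --> (x, v)] --> x by exact: cvg_fst.
  have sndc : z.2 @[z --> (x, v)] --> v by exact: cvg_snd.
  have frc : frame_mx z.1 @[z --> (x, v)] --> frame_mx x.
    exact: (cvg_comp _ _ fstc (@frame_mx_continuous x)).
  have ttc j : t j z.1 @[z --> (x, v)] --> t j x.
    exact: (cvg_comp _ _ fstc (tc j x x0)).
  have difc : t (widen_ord le_d i) z.1 - t last z.1 @[z --> (x, v)] -->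
      t (widen_ord le_d i) x - t last x by apply: cvgB; exact: ttc.
  have norc : (z.2 *m frame_mx z.1)^T @[z --> (x, v)] --> (v *m frame_mx x)^T.
    by apply: trmx_cvg; exact: mulmx_cvg.
  have entryc := mulmx_cvg (FF := nbhs_filter (x, v)) difc norc.
  rewrite mxE /=; under eq_cvg do rewrite mxE.
  exact: (cvg_comp _ _ entryc (@coord_continuous R 1 1 0 0 _)).
- apply/rowP => i; rewrite [LHS]mxE [RHS]mxE [in RHS]mxE /=.
  by rewrite mulNmx linearN mulmxN mxE.
- apply/rowP => i; rewrite [LHS]mxE [RHS]mxE /=.
  by rewrite /t plane_ofN frame_mxN mulmxA.
pose L := plane_of z.1; pose w := z.2 *m frame_mx z.1.
have wL : w \in gr_space L by apply/mem_plane_of => //; exists z.2.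
have w0 : w != 0 by apply: contraNneq z2 => /frame_mx_inj ->.
have tL i : t i z.1 \in gr_space L by exact: taut_section_mem.
have [H HL HP] := hyperplane_of_normal wL w0 (tL last).
exists L, H; split=> // i; apply: HP; first exact: tL.
(* [F] records the indices other than [last]; at [last] the difference is 0. *)
have [ilt|ige] := ltnP i (k + n).
  have /rowP/(_ (Ordinal ilt)) := Fz; rewrite [LHS]mxE [RHS]mxE => Fi.
  have ei : widen_ord le_d (Ordinal ilt) = i by exact: val_inj.
  by apply/rowP => a; rewrite ord1 [RHS]mxE -[RHS]Fi ei.
have -> : i = last.
  apply: val_inj => /=; apply/eqP; rewrite eqn_leq ige andbT.
  by rewrite -ltnS (leq_trans (ltn_ord i)) // addnS.
by rewrite subrr mul0mx.
Qed.

End ProjectiveFamily.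

Theorem corollary1p3 (R : realType) (d l : nat)
    (hd : (2 <= d)%N) (hl1 : (1 <= l)%N) (hl : (l <= d - 1)%N)
    (s : 'I_d -> grassmannian R d l -> taut_total R d l)
    (hs : forall i : 'I_d, taut_section (s i)) :
  exists (L : grassmannian R d l) (H : set 'rV[R]_d),
    affine_hyperplane_in L H /\ forall i : 'I_d, H (taut_vec (s i L)).
Proof.
have el : l = (l.-1 + 1)%N by rewrite addn1 prednK.
have ed : d = (l.-1 + (d - l).+1)%N.
  by rewrite -addSnnS prednK // subnKC // (leq_trans hl) // leq_subr.
move: (l.-1) (d - l)%N el ed => k n el ed.
subst l d; exact: sections_in_hyperplane.
Qed.
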